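(* Let $f : \mathcal{C}_d \to \mathbb{R}^+ \cup \{\infty\}$ be a monotone function that admits a Tverberg theorem and can be approximated by inscribed polytopes. Then $f$ admits a selection theorem.
   Context: $\mathbb{R}^+ = \{a \in \mathbb{R} : a \ge 0\}$ and $\mathcal{C}_d$ is the family of convex sets in $\mathbb{R}^d$. A function $f : \mathcal{C}_d \to \mathbb{R}^+ \cup \{\infty\}$ is monotone if $A \subset B$ implies $f(A) \le f(B)$. For a family $A$ of sets, $\bigcup A$ is the union of its members. $f$ can be approximated by inscribed polytopes if for every $1 > \varepsilon > 0$ there is a constant $C(f,d,\varepsilon)$ such that for every $\infty > \lambda \ge 0$ and every convex set $K \subset \mathbb{R}^d$ with $f(K) \ge \lambda$, there is a polytope $P \subset K$ with at most $C(f,d,\varepsilon)$ vertices such that $f(P) \ge (1-\varepsilon)\lambda$. $f$ admits a Tverberg theorem if, given $1 > \varepsilon > 0$, there is an integer $T(f,d,\varepsilon)$ such that for any positive integer $m$ and any real $\lambda > 0$, given a family $\mathcal{T} = \{T_1, \ldots, T_n\}$ of $n = (m-1)T(f,d,\varepsilon)+1$ convex sets $T_i \subset \mathbb{R}^d$ such that $f(T_i) \ge \lambda$ for all $i$, there is a partition of $\mathcal{T}$ into $m$ parts $A_1, \ldots, A_m$ such that $f\left(\bigcap_{j=1}^m \mathrm{conv}(\bigcup A_j)\right) \ge \lambda(1-\varepsilon)$. For $f$ monotone that can be approximated by inscribed polytopes, let $r(f,d,\varepsilon) = \max\{d \cdot C(f,d,\frac{\varepsilon}{2}),\, d+1\}$.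 Then $f$ admits a selection theorem if for any $1 > \varepsilon > 0$ there is a constant $\rho = \rho(f,d,\varepsilon) > 0$ such that for any $\lambda > 0$ and any finite family $\mathcal{T}$ of convex sets in $\mathbb{R}^d$, if $f(T) \ge \lambda$ for all $T \in \mathcal{T}$, there is a convex set $T_0$ with $f(T_0) \ge \lambda(1-\varepsilon)$ such that $T_0 \subset \mathrm{conv}(\bigcup A)$ for at least $\rho\binom{|\mathcal{T}|}{r(f,d,\varepsilon)}$ subsets $A \subset \mathcal{T}$ of cardinality $r(f,d,\varepsilon)$. *)

(* Defs.v *)
From HB Require Import structures.
From mathcomp Require Import all_boot all_order all_algebra.
From mathcomp Require Import all_classical all_reals all_analysis.
Set Implicit Arguments.
Unset Strict Implicit.
Unset Printing Implicit Defensive.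
Import Order.TTheory GRing.Theory Num.Theory.
Local Open Scope classical_set_scope.
Local Open Scope card_scope.
Local Open Scope convex_scope.
Local Open Scope ring_scope.

Section ConvexSets.
Context {R : realType} {d : nat}.
Implicit Types (P X : set 'rV[R]_d) (v : 'rV[R]_d).

Definition conv_hull X : set 'rV[R]_d := smallest (@convex_set R 'rV[R]_d) X.

(* The empty set is a polytope. *)
Definition polytope P := exists2 X, finite_set X & P = conv_hull X.

(* The vertices of a polytope are its extreme points. *)
Definition vertices P : set 'rV[R]_d :=
  [set v | P v /\
    forall (x y : convex_lmodType 'rV[R]_d) (t : {i01 R}),
      P x -> P y -> 0 < t%:num < 1 -> v = x <| t |> y -> x = v /\ y = v].

End ConvexSets.

Section SetFunctions.
Context {R : realType} {d : nat}.

(* A function from the convex sets of R^d to [0, +oo] is represented by a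
   function on all sets, of which only the values on convex sets matter. *)
Implicit Types f : set 'rV[R]_d -> \bar R.

Definition nonneg_on_convex f :=
  forall K : set 'rV[R]_d, convex_set K -> (0 <= f K)%E.

Definition monotone_on_convex f :=
  forall A B : set 'rV[R]_d,
    convex_set A -> convex_set B -> A `<=` B -> (f A <= f B)%E.

(* [C eps] is the constant C(f, d, eps); it is kept as a parameter because
   it occurs in the size of the subfamilies in a selection theorem. *)
Definition inscribed_polytope_approx f (C : R -> nat) :=
  forall eps : R, 0 < eps < 1 ->
  forall lambda : R, 0 <= lambda ->
  forall K : set 'rV[R]_d, convex_set K -> (lambda%:E <= f K)%E ->
  exists P : set 'rV[R]_d,
    [/\ polytope P, P `<=` K, vertices P #<= `I_(C eps) &
        (((1 - eps) * lambda)%:E <= f P)%E].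

(* Families are indexed, so that a set may occur several times; subfamilies
   are given by their sets of indices. *)
Definition conv_union n (T : 'I_n -> set 'rV[R]_d) (A : {set 'I_n}) :=
  conv_hull (\bigcup_(i in [set` A]) T i).

(* [finset.partition] requires the parts to be nonempty. *)
Definition admits_tverberg f :=
  forall eps : R, 0 < eps < 1 ->
  exists t : nat,
  forall m : nat, (0 < m)%N ->
  forall lambda : R, 0 < lambda ->
  forall T : 'I_((m - 1) * t + 1) -> set 'rV[R]_d,
    (forall i, convex_set (T i)) -> (forall i, (lambda%:E <= f (T i))%E) ->
  exists Q : {set {set 'I_((m - 1) * t + 1)}},
    [/\ finset.partition Q [set: 'I_((m - 1) * t + 1)]%SET, #|Q| = m &
        ((lambda * (1 - eps))%:E <=
          f (\bigcap_(A in [set` Q]) conv_union T A))%E].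

Definition selection_size (C : R -> nat) (eps : R) : nat :=
  maxn (d * C (eps / 2)) (d + 1).

(* The family is nonempty: for an empty one the conclusion would provide
   convex sets on which f is arbitrarily large, without any hypothesis. *)
Definition admits_selection f (C : R -> nat) :=
  forall eps : R, 0 < eps < 1 ->
  exists2 rho : R, 0 < rho &
  forall lambda : R, 0 < lambda ->
  forall (n : nat) (T : 'I_n -> set 'rV[R]_d), (0 < n)%N ->
    (forall i, convex_set (T i)) -> (forall i, (lambda%:E <= f (T i))%E) ->
  exists T0 : set 'rV[R]_d,
    [/\ convex_set T0, ((lambda * (1 - eps))%:E <= f T0)%E &
        rho * 'C(n, selection_size C eps)%:R <=
        #|[set A : {set 'I_n} | (#|A| == selection_size C eps) &&
                                `[< T0 `<=` conv_union T A >]]%SET|%:R].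

End SetFunctions.

Arguments selection_size {R} d C eps.

(* Main.v *)
Require Import Defs.
From HB Require Import structures.
From mathcomp Require Import all_boot all_order all_algebra.
From mathcomp Require Import all_classical all_reals all_analysis.
From mathcomp Require Import ring lra.

(** The argument is that of the classical first selection lemma, with points
    replaced by polytopes with a bounded number of vertices.

    Given [n] sets, the Tverberg property for [eps / 2] splits about [n] of
    them into [m], of the order of [n / t], parts whose hulls share a convex
    set [X] on which [f] is at least [lambda * (1 - eps / 2)]; inside [X] lies
    a polytope [P] with [k <= C (eps / 2)] vertices and [f P] at least
    [lambda * (1 - eps / 2) ^ 2 >= lambda * (1 - eps)].  Let [r] be the
    selection size.  Any [r] of the [m] parts contain a transversal, one index
    from each part, whose sets already have [P] in their convex hull
    ([transversal_hull]).  Distinct choices of parts give distinct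
    transversals, so there are at least ['C(m, r)] good subfamilies
    ([count_transversals]), and ['C(n, r) <= 'C(m, r) * (r * t) ^ r].  The same
    constant [rho = (r * t) ^- r] also covers the finitely many [n] for which
    [m < r], where a single good subfamily is enough.

    The geometric heart is [colourful_hull]: if the hull of each of [r] colour
    classes contains the points [p_1, ..., p_k], with [r >= d * k] and
    [r > d], then one point per class can be chosen so that the hull of the
    chosen points contains all the [p_j].  It relies on a colourful
    Caratheodory theorem with only [d] colours and an arbitrary extra point
    [q] ([colourful_pivot]): a rainbow choice [x] exists with [p] in the hull
    of [q] and [x].  The classes are cut into [k] blocks of [d] colours, and
    the theorem is applied to [p_j] and the [j]-th block, [q] being the
    centroid of the [p_j].  If some [p_j] were outside the hull of all chosen
    points, a linear form separating it would attain its maximum over the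
    [p_j] at a point which is strictly above the chosen points, and the only
    way for this point to be in the hull of [q] and the chosen points is to be
    [q]; being maximal at the centroid, the form is constant on the [p_j], and
    all the [p_j] coincide with [q].  In that case [d + 1] colours are used for
    the single point [q].

    Everything rests on one fact about finitely generated cones,
    [nearest_point].  Among the subsets of generators in a family closed
    under passing to subsets, it provides one whose cone comes closest to [b]
    and cannot be improved by adding a generator.  For the family of all
    subsets this is the separation theorem for finite sets; for the family of
    rainbow subsets it is Barany's colourful Caratheodory theorem for cones.
    Its proof compares finitely many orthogonal projections. *)

Set Implicit Arguments.
Unset Strict Implicit.
Unset Printing Implicit Defensive.
Import Order.TTheory GRing.Theory Num.Theory.
Local Open Scope ring_scope.

Local Ltac row_ring := apply/rowP => ?; rewrite !mxE; ring.

(** * The standard scalar product *)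

Section Dot.
Context {R : realFieldType} {n : nat}.
Implicit Types u v w : 'rV[R]_n.

Definition dot u v : R := \sum_j u 0 j * v 0 j.

Lemma dotC u v : dot u v = dot v u.
Proof. by apply: eq_bigr => j _; rewrite mulrC. Qed.

Lemma dotDr w u v : dot w (u + v) = dot w u + dot w v.
Proof. by rewrite -big_split; apply: eq_bigr => j _; rewrite mxE mulrDr. Qed.

Lemma dotZr w a u : dot w (a *: u) = a * dot w u.
Proof. by rewrite mulr_sumr; apply: eq_bigr => j _; rewrite mxE mulrCA. Qed.

Lemma dotNr w u : dot w (- u) = - dot w u.
Proof. by rewrite -scaleN1r dotZr mulN1r. Qed.

Lemma dotBr w u v : dot w (u - v) = dot w u - dot w v.
Proof. by rewrite dotDr dotNr. Qed.

Lemma dot0r w : dot w 0 = 0.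
Proof. by rewrite -(scale0r 0) dotZr mul0r. Qed.

Lemma dot_sumr (I : Type) (r : seq I) (P : pred I) w (F : I -> 'rV[R]_n) :
  dot w (\sum_(i <- r | P i) F i) = \sum_(i <- r | P i) dot w (F i).
Proof. exact: (big_morph (dot w) (dotDr w) (dot0r w)). Qed.

Lemma dotDl w u v : dot (u + v) w = dot u w + dot v w.
Proof. by rewrite dotC dotDr !(dotC w). Qed.

Lemma dotZl w a u : dot (a *: u) w = a * dot u w.
Proof. by rewrite dotC dotZr dotC. Qed.

Lemma dotNl w u : dot (- u) w = - dot u w.
Proof. by rewrite dotC dotNr dotC. Qed.

Lemma dotBl w u v : dot (u - v) w = dot u w - dot v w.
Proof. by rewrite dotDl dotNl. Qed.

Lemma dot_ge0 u : 0 <= dot u u.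
Proof. by apply: sumr_ge0 => j _; rewrite -expr2 sqr_ge0. Qed.

Lemma dot_eq0 u : (dot u u == 0) = (u == 0).
Proof.
apply/eqP/eqP => [uu0|->]; last exact: dot0r.
apply/rowP => j; rewrite mxE; apply/eqP; rewrite -sqrf_eq0 expr2; apply/eqP.
by apply: (psumr_eq0P _ uu0) => // i _; rewrite -expr2 sqr_ge0.
Qed.

Lemma dot_gt0 u : (0 < dot u u) = (u != 0).
Proof. by rewrite lt_neqAle dot_ge0 andbT eq_sym dot_eq0. Qed.

Lemma dot_pythagoras w u t : dot w u = 0 ->
  dot (w + t *: u) (w + t *: u) = dot w w + t ^+ 2 * dot u u.
Proof.
by move=> wu; rewrite !(dotDl, dotDr, dotZl, dotZr) (dotC u w) wu; ring.
Qed.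

Lemma dot_sqrB u v : dot u u - dot v v = dot u (u - v) + dot v (u - v).
Proof. by rewrite !dotBr (dotC v u); ring. Qed.

Lemma dot_sqr_subZ w u t :
  dot (w - t *: u) (w - t *: u) = dot w w - 2 * t * dot w u + t ^+ 2 * dot u u.
Proof. by rewrite !(dotBl, dotBr, dotZl, dotZr) (dotC u w); ring. Qed.

End Dot.

Lemma dot_row_mx (R : realFieldType) m n (a c : 'rV[R]_m) (b e : 'rV[R]_n) :
  dot (row_mx a b) (row_mx c e) = dot a c + dot b e.
Proof.
rewrite /dot big_split_ord; congr (_ + _); apply: eq_bigr => j _.
  by rewrite !row_mxEl.
by rewrite !row_mxEr.
Qed.

(** * Nearest points of finitely generated cones *)

Section Cone.
Context {R : realFieldType} {n : nat} {I : finType}.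
Variable v : I -> 'rV[R]_n.
Implicit Types (S : {set I}) (a c : I -> R) (b w : 'rV[R]_n).

Definition comb S a : 'rV[R]_n := \sum_(i in S) a i *: v i.

Definition independent S := forall a, comb S a = 0 -> {in S, forall i, a i = 0}.

Lemma comb_lin S c t a : comb S (fun i => c i + t * a i) = comb S c + t *: comb S a.
Proof.
rewrite /comb scaler_sumr -big_split; apply: eq_bigr => i _ /=.
by rewrite scalerDl scalerA.
Qed.

Lemma combD1 S c j : j \in S -> c j = 0 -> comb S c = comb (S :\ j) c.
Proof.
by move=> jS cj; rewrite /comb (big_setD1 j jS) /= cj scale0r add0r.
Qed.

Lemma dot_comb_eq0 S a w :
  (forall i, i \in S -> dot w (v i) = 0) -> dot w (comb S a) = 0.
Proof.
by move=> ort; rewrite dot_sumr big1 // => i /ort wi; rewrite dotZr wi mulr0.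
Qed.

(** Gram-Schmidt: a new generator [v j] contributes only through its component
    orthogonal to the others. *)
Lemma orthogonal_projection S b :
  exists a, forall j, j \in S -> dot (b - comb S a) (v j) = 0.
Proof.
have [m] := ubnP #|S|; elim: m S b => // m IHm S b ltSm.
have [->|[j jS]] := set_0Vmem S.
  by exists (fun=> 0) => j; rewrite inE.
have ltSjm : (#|S :\ j| < m)%N by rewrite -ltnS (leq_trans _ ltSm) // [#|S|](cardsD1 j) jS.
have [a aP] := IHm _ b ltSjm; have [e eP] := IHm _ (v j) ltSjm.
set w := b - _ in aP; set v' := v j - _ in eP.
pose t := dot w v' / dot v' v'.
pose c i := if i == j then t else a i - t * e i.
exists c.
have -> : comb S c = t *: v j + (comb (S :\ j) a - t *: comb (S :\ j) e).
  rewrite /comb (big_setD1 j jS) /= {1}/c eqxx; congr (_ + _).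
  rewrite scaler_sumr -sumrB; apply: eq_bigr => i; rewrite !inE /c.
  by case: eqP => //= _ _; rewrite scalerBl scalerA.
have -> : b - (t *: v j + (comb (S :\ j) a - t *: comb (S :\ j) e)) = w - t *: v'.
  by rewrite /w /v'; row_ring.
have ortS i : i \in S :\ j -> dot (w - t *: v') (v i) = 0.
  by move=> iS; rewrite dotBl dotZl aP // eP // mulr0 subr0.
move=> i iS; have [->|nij] := eqVneq i j; last by apply: ortS; rewrite !inE nij.
have -> : v j = v' + comb (S :\ j) e by rewrite /v' subrK.
rewrite dotDr dot_comb_eq0 // addr0 dotBl dotZl /t.
have [->|v'0] := eqVneq v' 0; first by rewrite !dot0r mulr0 subr0.
by rewrite divfK ?subrr // dot_eq0.
Qed.

(** Moving from [c] in the direction [a], the first coefficient to vanish is the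
    one that minimises [c i / - a i] among those which decrease. *)
Lemma leave_orthant S c a j0 :
    {in S, forall i, 0 <= c i} -> j0 \in S -> a j0 < 0 ->
  exists t j, [/\ 0 <= t, j \in S, a j < 0, c j + t * a j = 0 &
    {in S, forall i, 0 <= c i + t * a i}].
Proof.
move=> c_ge0 j0S aj0.
pose P i := (i \in S) && (a i < 0).
have Pj0 : P j0 by rewrite /P j0S.
case: (@arg_minP _ _ _ j0 P (fun i => c i / - a i) Pj0) => j /andP[jS aj] minj.
exists (c j / - a j), j; split => //.
- by rewrite divr_ge0 ?c_ge0 // oppr_ge0 ltW.
- by field; rewrite lt_eqF.
move=> i iS; have [ai|ai] := leP 0 (a i).
  by rewrite addr_ge0 ?c_ge0 // mulr_ge0 // divr_ge0 ?c_ge0 // oppr_ge0 ltW.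
have /minj : P i by rewrite /P iS.
by rewrite ler_pdivlMr ?oppr_gt0 // mulrN lerNl -subr_ge0 opprK addrC.
Qed.

(** From a point of the cone on [S], the generators can be reduced without moving
    away from [b] until they are independent and the point is the orthogonal
    projection of [b] on their span.  A linear relation lets a coefficient vanish
    without moving the point.  With independent generators, either the
    projection of [b] on their span is in the cone, or the segment going to this
    projection leaves the cone through the cone on fewer generators. *)
Lemma cone_projection S c b : {in S, forall i, 0 <= c i} ->
  exists S' a, [/\ S' \subset S, independent S', {in S', forall i, 0 <= a i},
    {in S', forall j, dot (b - comb S' a) (v j) = 0} &
    dot (b - comb S' a) (b - comb S' a) <= dot (b - comb S c) (b - comb S c)].
Proof.
have [m] := ubnP #|S|; elim: m S c => // m IHm S c ltSm c_ge0.
(* the induction hypothesis, once a coefficient has been driven to 0 *)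
have reduce c' j : j \in S -> c' j = 0 -> {in S, forall i, 0 <= c' i} ->
    dot (b - comb S c') (b - comb S c') <= dot (b - comb S c) (b - comb S c) ->
  exists S' a, [/\ S' \subset S, independent S', {in S', forall i, 0 <= a i},
    {in S', forall j, dot (b - comb S' a) (v j) = 0} &
    dot (b - comb S' a) (b - comb S' a) <= dot (b - comb S c) (b - comb S c)].
  move=> jS c'j c'_ge0; rewrite (combD1 jS c'j) => le_c.
  have [||S' [a [S'S indS' a_ge0 ort le_a]]] := IHm (S :\ j) c'.
  - by rewrite -ltnS (leq_trans _ ltSm) // [#|S|](cardsD1 j) jS.
  - by move=> i /setD1P[_ /c'_ge0].
  exists S', a; split => //; first exact: fintype.subset_trans S'S (subD1set _ _).
  exact: le_trans le_c.
have [indS|] := pselect (independent S); last first.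
  move=> /existsNP[a0 /not_implyP[a00 /existsNP[j0 /not_implyP[j0S aj0]]]].
  have {a0 a00 aj0}[a a0 aj0] : exists2 a, comb S a = 0 & a j0 < 0.
    have [ltj0|] := ltP (a0 j0) 0; first by exists a0.
    rewrite le_eqVlt eq_sym => /orP[/eqP //|gtj0].
    exists (fun i => 0 + -1 * a0 i); last by lra.
    by rewrite comb_lin a00 scaler0 addr0 /comb big1 // => i _; rewrite scale0r.
  have [t [j [t_ge0 jS aj cj c'_ge0]]] := leave_orthant c_ge0 j0S aj0.
  apply: (reduce _ _ jS cj c'_ge0).
  by rewrite comb_lin a0 scaler0 addr0.
have [a ort] := orthogonal_projection S b.
have [a_ge0|/existsNP[j0 /not_implyP[j0S /negP]]] :=
  pselect {in S, forall i, 0 <= a i}; last rewrite -ltNge => aj0.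
  exists S, a; split => //.
  have -> : b - comb S c = (b - comb S a) + 1 *: comb S (fun i => a i + -1 * c i).
    by rewrite comb_lin scale1r scaleN1r addrA subrK.
  rewrite dot_pythagoras; last exact: dot_comb_eq0.
  by rewrite expr1n mul1r lerDl dot_ge0.
pose e i := a i + -1 * c i.
have ej0 : e j0 < 0 by have := c_ge0 _ j0S; rewrite /e; lra.
have [t [j [t_ge0 jS ej cj c'_ge0]]] := leave_orthant c_ge0 j0S ej0.
apply: (reduce _ _ jS cj c'_ge0).
(* at time 1 the coefficient of [j0] would be negative *)
have t_le1 : t <= 1.
  by have := c'_ge0 _ j0S; have := c_ge0 _ j0S; rewrite /e; nra.
rewrite comb_lin.
have -> : b - comb S c = (b - comb S a) + 1 *: comb S e.
  by rewrite /e comb_lin; row_ring.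
have -> : b - (comb S c + t *: comb S e) = (b - comb S a) + (1 - t) *: comb S e.
  by rewrite /e comb_lin; row_ring.
rewrite !dot_pythagoras; try exact: dot_comb_eq0.
by rewrite lerD2l ler_wpM2r ?dot_ge0 // lerXn2r ?nnegrE //; lra.
Qed.

(** Compare the distances from [b] to the spans of the subsets [S] in [F] such
    that [b] projects into the cone on [S]; there are finitely many, so one is
    the smallest.  If the form [w = b - comb S a] were positive on a further
    generator [v i], a small move along [v i] would bring the point closer to
    [b], and [cone_projection] would turn it into a better subset. *)
Lemma nearest_point (F : {set I} -> Prop) b :
    F finset.set0 -> (forall S S', S' \subset S -> F S -> F S') ->
  exists S a, [/\ F S, independent S, {in S, forall i, 0 <= a i},
    {in S, forall i, dot (b - comb S a) (v i) = 0} &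
    forall i, F (i |: S) -> dot (b - comb S a) (v i) <= 0].
Proof.
move=> F0 Fsub.
pose good S a := [/\ F S, independent S, {in S, forall i, 0 <= a i} &
    {in S, forall i, dot (b - comb S a) (v i) = 0}].
pose goodS S := `[< exists a, good S a >].
have /choice[A AP] : forall S, exists a, goodS S -> good S a.
  move=> S; have [gS|_] := boolP (goodS S); last by exists (fun=> 0).
  by have /asboolP[a Sa] := gS; exists a.
have good0 : goodS finset.set0.
  apply/asboolP; exists (fun=> 0); split=> // [a _|] i; by rewrite inE.
pose D S := dot (b - comb S (A S)) (b - comb S (A S)).
case: (@arg_minP _ _ _ finset.set0 goodS D good0) => S gS minS.
have [FS indS a_ge0 ort] := AP _ gS.
exists S, (A S); split => // i FiS; rewrite leNgt; apply/negP => wi.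
set w := b - _ in wi ort; pose a := A S.
have iS : i \notin S by apply/negP => /ort wi0; rewrite wi0 ltxx in wi.
have vi : 0 < dot (v i) (v i).
  by rewrite dot_gt0; apply/eqP => vi; rewrite vi dot0r ltxx in wi.
(* the step along [v i] to the point nearest to [b] *)
pose s := dot w (v i) / dot (v i) (v i).
have s_gt0 : 0 < s by rewrite divr_gt0.
pose c k := if k == i then s else a k.
have c_ge0 : {in i |: S, forall k, 0 <= c k}.
  move=> k; rewrite !inE /c; case: eqP => [_ _|_ /= /a_ge0 //]; exact: ltW.
have [S' [a' [S'S indS' a'_ge0 ort' le_a']]] := cone_projection b c_ge0.
have FS' := Fsub _ _ S'S FiS.
have gS' : goodS S' by apply/asboolP; exists a'.
have [_ _ _ ortA] := AP _ gS'.
(* the residual of the orthogonal projection does not depend on coefficients *)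
have DS' : D S' = dot (b - comb S' a') (b - comb S' a').
  rewrite /D; set u := b - _; set u' := b - _.
  have uu' : u - u' = comb S' (fun k => a' k + -1 * A S' k).
    by rewrite comb_lin /u /u'; row_ring.
  by apply/eqP; rewrite -subr_eq0 dot_sqrB uu' !dot_comb_eq0 // addr0.
have := minS _ gS'; rewrite DS' => /le_trans /(_ le_a').
have -> : b - comb (i |: S) c = w - s *: v i.
  rewrite /comb big_setU1 //= {1}/c eqxx /w /comb opprD addrA addrAC.
  congr (_ - _ - _); apply: eq_bigr => k kS; rewrite /c; case: eqP kS => // ->.
  by rewrite (negPf iS).
have ss : s * dot (v i) (v i) = dot w (v i) by rewrite divfK // gt_eqF.
rewrite -/(D S) /D -/w dot_sqr_subZ expr2 -(mulrA s s) ss.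
have := mulr_gt0 s_gt0 wi; lra.
Qed.

(** Adding [w] to the family keeps it independent, whence the rank bound. *)
Lemma independent_orthogonal_card S w :
    independent S -> w != 0 -> {in S, forall i, dot w (v i) = 0} ->
  (#|S| < n)%N.
Proof.
move=> indS w0 ort.
pose M : 'M[R]_(#|S| + 1, n) :=
  col_mx (\matrix_(k < #|S|) v (enum_val k)) w.
have rfM : row_free M.
  apply: inj_row_free => u; rewrite -[u]hsubmxK mul_row_col.
  set ul := lsubmx u; set ur := rsubmx u => uM.
  pose a i := if [pick k : 'I_#|S| | enum_val k == i] is Some k then ul 0 k else 0.
  have aE k : a (enum_val k) = ul 0 k.
    rewrite /a; case: pickP => [k' /eqP/enum_val_inj -> //|/(_ k)].
    by rewrite eqxx.
  have combE : comb S a = ul *m (\matrix_(k < #|S|) v (enum_val k)).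
    rewrite mulmx_sum_row /comb (big_enum_val (A := mem S)) /=; apply: eq_bigr => k _.
    by rewrite rowK aE.
  have ur1 : ur = (ur 0 0)%:M by apply: mx11_scalar.
  rewrite -combE ur1 mul_scalar_mx in uM.
  have ur0 : ur 0 0 = 0.
    have := congr1 (dot w) uM.
    rewrite dot0r dotDr dotZr dot_comb_eq0 // add0r => /eqP.
    by rewrite mulf_eq0 dot_eq0 (negPf w0) orbF => /eqP.
  rewrite ur0 scale0r addr0 in uM.
  have -> : ul = 0.
    by apply/rowP => k; rewrite [RHS]mxE -aE (indS a uM) // enum_valP.
  by rewrite ur1 ur0 -scalemx1 scale0r row_mx0.
by rewrite -addn1 -(eqP rfM) rank_leq_col.
Qed.

End Cone.

(** * Colourful cones and separation *)

(** Barany's theorem.  The hypothesis on [b] is the dual form of: the cone on each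
    colour class contains [b].  Take a nearest point for the family of rainbow
    sets of generators.  If its residual [w] were nonzero, fewer than [n] colours
    would be used, [w] being orthogonal to independent generators; an unused
    colour has a generator on which [w] is positive, and it can be added. *)
Lemma colourful_cone (R : realFieldType) n (I K : finType) (v : I -> 'rV[R]_n)
    (col : I -> K) (A : {set K}) (b : 'rV[R]_n) :
    (n <= #|A|)%N ->
    (forall k w, k \in A -> 0 < dot w b -> exists2 i, col i = k & 0 < dot w (v i)) ->
  exists S : {set I}, exists c : I -> R, [/\ {in S &, injective col},
    {in S, forall i, col i \in A}, {in S, forall i, 0 <= c i} & b = comb v S c].
Proof.
move=> leA inA.
pose F (S : {set I}) := {in S &, injective col} /\ {in S, forall i, col i \in A}.
have [||S [c [[injS colS] indS c_ge0 ort max]]] := @nearest_point _ _ _ v F b.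
- by split => i; rewrite inE.
- move=> S S' /fintype.subsetP S'S [injS colS]; split.
    by move=> i j /S'S iS /S'S jS; exact: injS.
  by move=> i /S'S/colS.
exists S, c; split => //; apply/eqP; rewrite -subr_eq0; apply/negPn/negP => w0.
set w := b - _ in ort max w0.
have [k /setDP[kA kS]] : exists k, k \in A :\: col @: S.
  apply/set0Pn; rewrite finset.setD_eq0; apply/negP => /subset_leq_card.
  rewrite card_in_imset // => leAS.
  have := independent_orthogonal_card indS w0 ort.
  by rewrite ltnNge (leq_trans leA leAS).
have wb : 0 < dot w b.
  have -> : b = w + comb v S c by rewrite subrK.
  by rewrite dotDr dot_comb_eq0 // addr0 dot_gt0.
have [i colik wi] := inA k w kA wb.
have nin j : j \in S -> col j != k.
  by move=> jS; apply: contraNneq kS => <-; exact: imset_f.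
suff /max : F (i |: S) by rewrite leNgt wi.
split=> [j1 j2|j]; rewrite !inE; last by case/predU1P => [->|/colS //]; rewrite colik.
case/predU1P => [->|j1S] /predU1P[->|j2S] //; last exact: injS.
  by rewrite colik => /esym/eqP; rewrite (negPf (nin _ j2S)).
by rewrite colik => /eqP; rewrite (negPf (nin _ j1S)).
Qed.

(** Appending a coordinate 1 turns convex combinations of the [y i] equal to [p]
    into conical combinations of the [(y i - p, 1)] equal to [(0, 1)].  If there
    are none, the nearest point of the cone provides the separating form. *)
Lemma separation_or_comb (R : realFieldType) n (I : finType) (y : I -> 'rV[R]_n)
    (p : 'rV[R]_n) :
  (exists w, forall i, dot w (y i) < dot w p) \/
  (exists2 c : I -> R, (forall i, 0 <= c i) &
     \sum_i c i = 1 /\ \sum_i c i *: y i = p).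
Proof.
pose v i : 'rV[R]_(n + 1) := row_mx (y i - p) (const_mx 1).
pose b : 'rV[R]_(n + 1) := row_mx 0 (const_mx 1).
have [//|//|S [a [_ indS a_ge0 ort max]]] :=
  @nearest_point _ _ _ v (fun=> True) b.
have [w0|w0] := eqVneq (b - comb v S a) 0; [right|left].
  exists (fun i => if i \in S then a i else 0).
    by move=> i; case: ifP => // /a_ge0.
  have combE : comb v S a = row_mx (\sum_(i in S) a i *: (y i - p))
                                   (const_mx (\sum_(i in S) a i)).
    rewrite /comb; apply/rowP => j; rewrite summxE -[j]splitK.
    case: (fintype.split j) => k /=; rewrite ?row_mxEl ?row_mxEr.
      by rewrite summxE; apply: eq_bigr => i _; rewrite [LHS]mxE /v row_mxEl [RHS]mxE.
    by rewrite [RHS]mxE; apply: eq_bigr => i _; rewrite mxE /v row_mxEr mxE mulr1.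
  move/eqP: w0; rewrite combE subr_eq0 => /eqP/eq_row_mx[e0 e1].
  have s1 : \sum_(i in S) a i = 1.
    by have := congr1 (fun M : 'rV_1 => M 0 0) e1; rewrite !mxE.
  rewrite -big_mkcond /= s1; split => //.
  transitivity (\sum_(i in S) a i *: y i).
    by rewrite [RHS]big_mkcond; apply: eq_bigr => i _; case: ifP; rewrite ?scale0r.
  move/esym/eqP: e0; under eq_bigr do rewrite scalerBr.
  by rewrite sumrB -scaler_suml s1 scale1r subr_eq0 => /eqP.
have wb : 0 < dot (b - comb v S a) b.
  rewrite -[X in dot _ X](subrK (comb v S a)) dotDr (dot_comb_eq0 a ort).
  by rewrite addr0 dot_gt0.
set w := b - _ in ort max wb w0.
exists (lsubmx w) => i; have := max i Logic.I; move: wb.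
rewrite /v /b -{1 2}[w]hsubmxK !dot_row_mx dot0r add0r dotBr; lra.
Qed.

Local Open Scope classical_set_scope.
Local Open Scope card_scope.
Local Open Scope convex_scope.

(** * Convex hulls *)

Section ConvexHull.
Context {R : realType} {n : nat}.
Implicit Types (K X Y : set 'rV[R]_n) (p q w : 'rV[R]_n).

Lemma convex_setP K : convex_set K <->
  (forall x y (t : R), 0 <= t <= 1 -> K x -> K y -> K (t *: x + (1 - t) *: y)).
Proof.
split=> [cK x y t /andP[t0 t1] Kx Ky|cK x y t].
  have := cK x y (Itv01 t0 t1); rewrite !inE; exact.
rewrite !inE => Kx Ky; apply: cK => //.
by rewrite ge0 le1.
Qed.

Lemma conv_hull_convex X : convex_set (conv_hull X).
Proof.
apply/convex_setP => x y t t01 Xx Xy K /= [cK XK].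
by move/convex_setP: (cK); apply; [|exact: Xx|exact: Xy].
Qed.

Lemma sub_conv_hull X : X `<=` conv_hull X.
Proof. exact: sub_gen_smallest. Qed.

Lemma conv_hull_min K X : convex_set K -> X `<=` K -> conv_hull X `<=` K.
Proof. exact: smallest_sub. Qed.

Lemma conv_hull_mono X Y : X `<=` Y -> conv_hull X `<=` conv_hull Y.
Proof.
move=> XY; apply: conv_hull_min; first exact: conv_hull_convex.
exact: classical_sets.subset_trans XY (@sub_conv_hull _).
Qed.

Lemma convex_sum (K : set 'rV[R]_n) (I : eqType) (s : seq I) (c : I -> R)
    (y : I -> 'rV[R]_n) :
    convex_set K -> {in s, forall i, 0 <= c i} -> {in s, forall i, K (y i)} ->
    \sum_(i <- s) c i = 1 ->
  K (\sum_(i <- s) c i *: y i).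
Proof.
move=> /convex_setP cK c_ge0 Ky c1.
(* for the induction, the sum of the weights has to be arbitrary *)
suff scaled : 0 < \sum_(i <- s) c i ->
    K ((\sum_(i <- s) c i)^-1 *: \sum_(i <- s) c i *: y i).
  by move: scaled; rewrite c1 invr1 scale1r; apply; rewrite ltr01.
elim: s c_ge0 Ky {c1} => [|i s IHs] c_ge0 Ky; first by rewrite big_nil ltxx.
have ci : 0 <= c i by apply: c_ge0; rewrite mem_head.
have cs : {in s, forall j, 0 <= c j} by move=> j js; rewrite c_ge0 // mem_behead.
have Kys : {in s, forall j, K (y j)} by move=> j js; apply: Ky; rewrite mem_behead.
rewrite !big_cons; set t := \sum_(j <- s) _; set u := \sum_(j <- s) _.
have t_ge0 : 0 <= t by rewrite /t big_seq; exact: sumr_ge0.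
move=> cit; have [t0|t0] := eqVneq t 0.
  have -> : u = 0.
    move/eqP: t0; rewrite /t big_seq psumr_eq0 // => /allP c0.
    rewrite /u big_seq big1 // => j js.
    by have := c0 j js; rewrite js => /eqP ->; rewrite scale0r.
  rewrite t0 !addr0 scalerA mulVf ?scale1r; first by apply: Ky; rewrite mem_head.
  by rewrite gt_eqF // -[c i]addr0 -{2}t0.
have t_gt0 : 0 < t by rewrite lt_neqAle eq_sym t0.
have -> : (c i + t)^-1 *: (c i *: y i + u) =
    (c i / (c i + t)) *: y i + (1 - c i / (c i + t)) *: (t^-1 *: u).
  rewrite scalerDr !scalerA mulrC; congr (_ + _ *: _).
  by field; rewrite t0 gt_eqF.
apply: cK; last exact: IHs.
  by rewrite divr_ge0 ?addr_ge0 // ler_pdivrMr // mul1r lerDl.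
by apply: Ky; rewrite mem_head.
Qed.

Lemma open_halfspace_convex w (M : R) : convex_set [set x | dot w x < M].
Proof.
apply/convex_setP => x y t /andP[t0 t1] /=; rewrite dotDr !dotZr => xM yM.
have [->|t_neq0] := eqVneq t 0; first by rewrite mul0r add0r subr0 mul1r.
have : 0 < t by rewrite lt_neqAle eq_sym t_neq0.
nra.
Qed.

(** This convexity shows that, when a form attains its maximum on the generators
    of a convex hull at [q] alone, it attains it on the hull at [q] alone. *)
Lemma pointed_halfspace_convex w q :
  convex_set [set x | x = q \/ dot w x < dot w q].
Proof.
apply/convex_setP => x y t /andP[t0 t1] /=.
have [->|t_neq0] := eqVneq t 0; first by rewrite scale0r add0r subr0 scale1r.
have [->|t_neq1] := eqVneq t 1.
  by rewrite scale1r subrr scale0r addr0.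
have t_gt0 : 0 < t by rewrite lt_neqAle eq_sym t_neq0.
have t_lt1 : t < 1 by rewrite lt_neqAle t_neq1.
case=> [->|xq] [->|yq]; [left|right|right|right].
- by rewrite -scalerDl addrC subrK scale1r.
- rewrite dotDr !dotZr; nra.
- rewrite dotDr !dotZr; nra.
- rewrite dotDr !dotZr; nra.
Qed.

Lemma conv_hull_seq X p : conv_hull X p ->
  exists s : seq 'rV[R]_n, [set` s] `<=` X /\ conv_hull [set` s] p.
Proof.
move: p; apply: conv_hull_min; last first.
  move=> p Xp; exists [:: p]; split.
    by move=> x /=; rewrite inE => /eqP ->.
  by apply: sub_conv_hull => /=; rewrite inE.
apply/convex_setP => x y t t01 [s [sX sx]] [s' [s'X s'y]].
exists (s ++ s'); split.
  by move=> z /=; rewrite mem_cat => /orP[/sX|/s'X].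
have /convex_setP := @conv_hull_convex [set` s ++ s']; apply => //.
  by apply: conv_hull_mono sx => z /= zs; rewrite mem_cat zs.
by apply: conv_hull_mono s'y => z /= zs; rewrite mem_cat zs orbT.
Qed.

Lemma conv_hull_separation (I : finType) (y : I -> 'rV[R]_n) (P : pred I) p :
    ~ conv_hull (y @` [set` P]) p ->
  exists w, forall i, P i -> dot w (y i) < dot w p.
Proof.
move=> np.
have [[w wp]|[c c_ge0 [c1 cp]]] := separation_or_comb (fun i : {i | P i} => y (val i)) p.
  by exists w => i Pi; exact: (wp (Sub i Pi)).
case: np; rewrite -cp; apply: convex_sum => //; first exact: conv_hull_convex.
by move=> i _; apply: sub_conv_hull; exists (val i) => //; exact: (valP i).
Qed.

Lemma conv_hull_supporting w X p : conv_hull X p ->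
  exists2 x, X x & dot w p <= dot w x.
Proof.
move=> Xp; apply/not_exists2P => noX.
suff : conv_hull X `<=` [set x | dot w x < dot w p] by move/(_ p Xp); rewrite /= ltxx.
apply: conv_hull_min; first exact: open_halfspace_convex.
by move=> x Xx /=; rewrite ltNge; apply/negP; have [] := noX x.
Qed.

End ConvexHull.

(** * Rainbow hulls of points *)

Lemma small_scale (R : realFieldType) (J : finType) (P : pred J) (a b : J -> R) :
    (forall j, P j -> 0 < a j) ->
  exists2 e, 0 < e & forall j, P j -> e * b j < a j.
Proof.
move=> a_gt0; pose t := 1 + \sum_(j | P j) `|b j| / a j.
have t_ge j : P j -> 1 + `|b j| / a j <= t.
  move=> Pj; rewrite lerD2l (bigD1 j) //= lerDl sumr_ge0 // => i /andP[Pi _].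
  by rewrite divr_ge0 // ltW // a_gt0.
have t_gt0 : 0 < t.
  by rewrite ltr_wpDr // sumr_ge0 // => i Pi; rewrite divr_ge0 // ltW // a_gt0.
exists t^-1; first by rewrite invr_gt0.
move=> j Pj; rewrite mulrC ltr_pdivrMr //.
apply: lt_le_trans (_ : a j * (1 + `|b j| / a j) <= _).
  rewrite mulrDr mulr1 mulrCA divff ?gt_eqF ?a_gt0 // mulr1.
  by rewrite (le_lt_trans (ler_norm _)) // ltrDr a_gt0.
by rewrite ler_pM2l ?a_gt0 // t_ge.
Qed.

Section Colourful.
Context {R : realType} {n : nat}.
Implicit Types (p q w : 'rV[R]_n).

(** Barany's theorem for cones does not apply to the classes [X k] seen from [p]
    and the direction [p - q], which need not be in the cones on the [X k - p].
    It does after the classes are pushed slightly, by [e *: (p - q)].  Were no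
    rainbow set to have [p] in its hull with [q], each would be separated from
    [p] by a form; the pushed set is still on the same side of this form, if [e]
    is small enough for the finitely many rainbow sets, and [p - q] is on the
    other side, hence not in the cone on the pushed set. *)
Lemma colourful_pivot (K : finType) (A : {set K}) (X : K -> set 'rV[R]_n) p q :
    (n <= #|A|)%N -> (forall k, k \in A -> conv_hull (X k) p) ->
  exists x : K -> 'rV[R]_n, (forall k, k \in A -> X k (x k)) /\
    conv_hull (q |` x @` [set` A]) p.
Proof.
move=> leA Xp.
have /choice[Y YP] : forall k, exists s : seq 'rV[R]_n,
    k \in A -> [set` s] `<=` X k /\ conv_hull [set` s] p.
  move=> k; have [kA|_] := boolP (k \in A); last by exists [::].
  by have [s sP] := conv_hull_seq (Xp k kA); exists s.
(* finite subclasses are enough, and their points are indexed with colours *)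
pose I : finType := {k : K & 'I_(size (Y k))}.
pose y (i : I) := nth 0 (Y (tag i)) (tagged i).
have yY i : y i \in Y (tag i) by rewrite mem_nth.
pose rainbow (S : {set I}) :=
  {in S &, injective (@tag _ _ : I -> K)} /\ {in S, forall i, tag i \in A}.
have [S [injS SA] Sp] : exists2 S, rainbow S & conv_hull (q |` y @` [set` S]) p.
  apply/not_exists2P => noS.
  have /choice[W WP] : forall S, exists w, rainbow S ->
      dot w q < dot w p /\ {in S, forall i, dot w (y i) < dot w p}.
    move=> S; have [rS|] := pselect (rainbow S); last by exists 0.
    pose y' (o : option I) := if o is Some i then y i else q.
    pose P' (o : option I) := if o is Some i then i \in S else true.
    have [|w wP] := @conv_hull_separation _ _ _ y' P' p.
      have [//|nSp] := noS S; apply: contra_not nSp.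
      apply: conv_hull_mono => _ [[i|] /= iS <-]; last by left.
      by right; exists i.
    exists w => _; split; first exact: (wP None).
    by move=> i iS; exact: (wP (Some i)).
  have [|e e_gt0 eP] := @small_scale _ _
      (fun j : {set I} * I => `[< rainbow j.1 >] && (j.2 \in j.1))
      (fun j => dot (W j.1) (p - y j.2)) (fun j => dot (W j.1) (p - q)).
    move=> [S i] /= /andP[/asboolP/WP[_ wS] /wS].
    by rewrite dotBr subr_gt0.
  have [|k w kA wpq|S [c [injS SA c_ge0 pqE]]] :=
      @colourful_cone _ _ I K (fun i => y i - p - e *: (q - p)) (@tag _ _) A (p - q) => //.
    have [sX sp] := YP k kA.
    have [z zY le_z] := conv_hull_supporting w sp.
    have zlt : (index z (Y k) < size (Y k))%N by rewrite index_mem.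
    exists (Tagged (fun k => 'I_(size (Y k))) (Ordinal zlt)) => //.
    rewrite /y /= nth_index // !dotBr dotZr dotBr.
    move: wpq; rewrite dotBr => wpq; have : 0 < e * (dot w p - dot w q) by rewrite mulr_gt0.
    lra.
  have rS : rainbow S by split.
  have [] := WP S rS; rewrite -subr_gt0 -dotBr {1}pqE => + _; apply/negP; rewrite -leNgt.
  rewrite dot_sumr sumr_le0 // => i iS; rewrite dotZr mulr_ge0_le0 ?c_ge0 //.
  have /(_ (S, i)) /= := eP; rewrite iS asboolT // => /(_ isT).
  rewrite !dotBr dotZr dotBr; lra.
have /choice[x0 x0P] : forall k, exists x, k \in A -> X k x.
  move=> k; have [kA|_] := boolP (k \in A); last by exists 0.
  by have [x Xx _] := conv_hull_supporting 0 (Xp k kA); exists x.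
exists (fun k => if [pick i in S | tag i == k] is Some i then y i else x0 k); split.
  move=> k kA; case: pickP => [i /andP[iS /eqP ik]|_]; last exact: x0P.
  have [sX _] := YP k kA; apply: sX => /=.
  by have := yY i; rewrite ik.
apply: conv_hull_mono Sp => _ [->|[i iS <-]]; first by left.
right; exists (tag i) => /=; first exact: SA.
case: pickP => [j /andP[jS /eqP ji]|/(_ i)]; last by rewrite iS eqxx.
by rewrite (injS _ _ jS iS ji).
Qed.

(** The extra point of [colourful_pivot] is taken in a colour class set aside. *)
Lemma colourful_caratheodory (K : finType) (X : K -> set 'rV[R]_n) p :
    (n < #|K|)%N -> (forall k, conv_hull (X k) p) ->
  exists x : K -> 'rV[R]_n, (forall k, X k (x k)) /\ conv_hull (range x) p.
Proof.
move=> ltK Xp.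
have /card_gt0P[k0 _] : (0 < #|K|)%N by exact: leq_ltn_trans ltK.
have [q Xq _] := conv_hull_supporting 0 (Xp k0).
have [||x [xX xp]] := @colourful_pivot K (finset.setT :\ k0) X p q.
- by rewrite -ltnS (leq_trans ltK) // -cardsT [#|[set: K]%SET|](cardsD1 k0) !inE.
- by move=> k _.
exists (fun k => if k == k0 then q else x k); split.
  by move=> k; case: eqP => [->//|/eqP nk]; apply: xX; rewrite !inE nk.
apply: conv_hull_mono xp => _ [->|[k /= kA <-]].
  by exists k0 => //; rewrite eqxx.
by exists k => //; move: kA; rewrite !inE => /andP[/negPf ->].
Qed.

Lemma balanced_blocks (K : finType) k (j0 : 'I_k) : (n * k <= #|K|)%N ->
  exists blk : K -> 'I_k, forall j, (n <= #|[set i | blk i == j]%SET|)%N.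
Proof.
move=> leK.
exists (fun i => insubd j0 (enum_rank i %/ n)%N) => j.
have lt_nk (l : 'I_n) : (j * n + l < #|K|)%N.
  apply: leq_trans leK; apply: (@leq_trans (j.+1 * n)%N).
    by rewrite mulSn addnC ltn_add2r.
  by rewrite mulnC leq_mul2l ltn_ord orbT.
pose g (l : 'I_n) : K := enum_val (Ordinal (lt_nk l)).
have g_inj : injective g.
  by move=> l1 l2 /enum_val_inj/(congr1 val) /= /eqP; rewrite eqn_add2l => /eqP/val_inj.
rewrite -[X in (X <= _)%N]card_ord -cardsT -(card_imset _ g_inj); apply/subset_leq_card.
apply/fintype.subsetP => _ /imsetP[l _ ->]; rewrite inE; apply/eqP/val_inj.
rewrite /g enum_valK val_insubd /= divnMDl ?divn_small ?addn0 ?ltn_ord //.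
exact: leq_trans (ltn_ord l).
Qed.

(** The classes are cut into one block of [n] colours for each [p j], with the
    centroid [q] of the [p j] as extra point.  A linear form separating some [p j]
    from the chosen points has its maximum over the [p j] at points above all the
    chosen ones; as each [p j] is in the hull of [q] and chosen points, the
    maximum is reached at [q] too.  It is then reached at every [p j], and a point
    of such a hull at which it is reached can only be [q].  So all the [p j]
    coincide, and [colourful_caratheodory] settles this case. *)
Lemma colourful_hull (K : finType) k (p : 'I_k -> 'rV[R]_n) (X : K -> set 'rV[R]_n) :
    (0 < k)%N -> (n * k <= #|K|)%N -> (n < #|K|)%N ->
    (forall i j, conv_hull (X i) (p j)) ->
  exists x : K -> 'rV[R]_n, (forall i, X i (x i)) /\ forall j, conv_hull (range x) (p j).
Proof.
move=> k_gt0 leK ltK Xp; pose j0 := Ordinal k_gt0.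
have [all_eq|/existsNP[j1 /eqP pj1]] := pselect (forall j, p j = p j0).
  have [x [xX xp]] := colourful_caratheodory ltK (fun i => Xp i j0).
  by exists x; split=> // j; rewrite all_eq.
have [blk blkP] := balanced_blocks j0 leK.
pose q : 'rV[R]_n := k%:R^-1 *: \sum_j p j.
have /choice[x xP] : forall j, exists x : K -> 'rV[R]_n,
    (forall i, i \in [set i | blk i == j]%SET -> X i (x i)) /\
    conv_hull (q |` x @` [set` [set i | blk i == j]%SET]) (p j).
  by move=> j; apply: colourful_pivot => // i _.
pose z i := x (blk i) i.
exists z; split=> [i|]; first by apply: (xP (blk i)).1; rewrite inE.
apply: contrapT => /existsNP[j nj].
have [w wz] : exists w, forall i, predT i -> dot w (z i) < dot w (p j).
  apply: conv_hull_separation; apply: contra_not nj.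
  by apply: conv_hull_mono => _ [i _ <-]; exists i.
case: (@arg_maxP _ _ _ j predT (fun j => dot w (p j)) isT) => j2 _ maxj.
have q_le : dot w q <= dot w (p j2).
  rewrite dotZr dot_sumr ler_pdivrMl ?ltr0n // mulr_natl.
  rewrite -[X in _ *+ X]card_ord -sumr_const; apply: ler_sum => i _; exact: maxj.
have zlt i : dot w (z i) < dot w (p j2) by apply: lt_le_trans (maxj j isT); exact: wz.
have sub_z (P : set 'rV[R]_n) j' : convex_set P -> P q -> (forall i, P (z i)) -> P (p j').
  move=> cP Pq Pz; apply: (conv_hull_min cP _ (xP j').2).
  by move=> _ [->//|[i /= ij <-]]; have := Pz i; rewrite /z; move: ij; rewrite inE => /eqP ->.
have [q_lt|] := ltP (dot w q) (dot w (p j2)).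
  have := sub_z _ j2 (@open_halfspace_convex _ _ w _) q_lt zlt.
  by rewrite /= ltxx.
move=> le_q; have qE : dot w q = dot w (p j2) by apply/le_anti/andP.
have pE j' : dot w (p j') = dot w (p j2).
  have sum0 : \sum_i (dot w (p j2) - dot w (p i)) = 0.
    rewrite sumrB sumr_const card_ord -dot_sumr -qE /q dotZr -[X in X - _]mulr_natl.
    by rewrite mulrA divff ?mul1r ?subrr // pnatr_eq0 -lt0n.
  apply/esym/eqP; rewrite -subr_eq0; apply/eqP.
  by apply: (psumr_eq0P _ sum0) => // i _; rewrite subr_ge0; exact: maxj.
have pq j' : p j' = q.
  have [||//|] := sub_z _ j' (@pointed_halfspace_convex _ _ w q).
  - by left.
  - by move=> i; right; rewrite qE.
  - by rewrite qE pE ltxx.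
by move: pj1; rewrite !pq eqxx.
Qed.

(** * Polytopes and their vertices *)

(** A generating sequence [s] of minimal size works: each [x] in [s] is
    strictly separated from the hull of the others by a form [w], so [x] is the
    only point of the polytope where [w] is maximal. *)
Lemma polytope_vertices (P : set 'rV[R]_n) : polytope P ->
  exists2 s : seq 'rV[R]_n, uniq s & P = conv_hull [set` s] /\ [set` s] `<=` vertices P.
Proof.
case=> X /finite_seqP[s0 ->] ->.
set P0 := conv_hull _.
pose gen m := `[< exists2 s : seq 'rV[R]_n, size s = m & P0 = conv_hull [set` s] >].
have ex_gen : exists m, gen m by exists (size s0); apply/asboolP; exists s0.
case: (ex_minnP ex_gen) => m /asboolP[s sm Ps] minm.
have [lt_undup|us] := ltnP (size (undup s)) (size s).
  have : gen (size (undup s)).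
    apply/asboolP; exists (undup s) => //; rewrite Ps; congr conv_hull.
    by apply/seteqP; split=> x /=; rewrite mem_undup.
  by move/minm; rewrite -sm leqNgt lt_undup.
have {}us : uniq s.
  by rewrite (uniq_size_uniq (undup_uniq s) (mem_undup s)) eqn_leq us size_undup.
exists s => //; split => // x /= xs.
pose s' := rem x s.
have ss' y : y \in s -> y = x \/ y \in s'.
  by move=> ys; rewrite mem_rem_uniq // !inE ys andbT; case: eqP; [left|right].
have s's : {subset s' <= s} by exact: mem_rem.
have nx : ~ conv_hull [set` s'] x.
  move=> s'x; have : gen (size s').
    apply/asboolP; exists s' => //; rewrite Ps; apply/seteqP; split.
      apply: conv_hull_min; first exact: conv_hull_convex.
      by move=> y /ss'[->//|ys']; exact: sub_conv_hull.
    by apply: conv_hull_mono => y /s's.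
  move/minm; rewrite -sm size_rem // leqNgt prednK ?leqnn //.
  by case: s xs {us sm Ps s' ss' s's s'x}.
have [w wP] : exists w, forall i : seq_sub s', predT i -> dot w (val i) < dot w x.
  apply: conv_hull_separation; apply: contra_not nx; apply: conv_hull_mono.
  by move=> _ [i _ <-] /=; exact: (valP i).
have face y : P0 y -> y = x \/ dot w y < dot w x.
  rewrite Ps; move: y; apply: conv_hull_min; first exact: pointed_halfspace_convex.
  by move=> y /ss'[->|ys']; [left|right; exact: (wP (SeqSub ys'))].
split; first by rewrite Ps; exact: sub_conv_hull.
move=> y z t P0y P0z /andP[t0 t1] xE.
have {}xE : x = t%:num *: y + (1 - t%:num) *: z by exact: xE.
have := congr1 (dot w) xE; rewrite dotDr !dotZr => wE.
have [yx|ylt] := face y P0y; have [zx|zlt] := face z P0z => //; exfalso.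
- by move: wE; rewrite yx; nra.
- by move: wE; rewrite zx; nra.
- by move: wE; nra.
Qed.

End Colourful.

Lemma size_le_card (T : eqType) (x0 : T) (s : seq T) (V : set T) N :
  uniq s -> [set` s] `<=` V -> V #<= `I_N -> (size s <= N)%N.
Proof.
move=> us sV VN; rewrite -card_le_II; apply: card_le_trans VN.
have inj_nth : {in `I_(size s) &, injective (nth x0 s)}.
  move=> i j; rewrite !inE /= => ilt jlt /eqP.
  by rewrite nth_uniq // => /eqP.
rewrite -(card_le_eql (inj_card_eq inj_nth)); apply: subset_card_le.
by move=> _ [i /= ilt <-]; apply: sV; exact: mem_nth.
Qed.

(** * Counting *)

(** Factor by factor, [m <= (m - i) * r] for [i < r <= m]. *)
Lemma leq_expn_ffact m r : (r <= m)%N -> (m ^ r <= m ^_ r * r ^ r)%N.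
Proof.
move=> le_rm; rewrite ffact_prod.
have expE k : (k ^ r = \prod_(i < r) k)%N by rewrite prod_nat_const card_ord.
rewrite (expE m) (expE r) -big_split; apply: leq_prod => i _ /=.
have [le_ir lt_ir] : (i <= m /\ i.+1 <= r)%N.
  by rewrite ltn_ord (leq_trans (ltnW (ltn_ord i))).
(* [k * i.+1 >= i + k] for the positive number [k = m - i] *)
apply: (@leq_trans ((m - i) * i.+1)); last by rewrite leq_mul2l lt_ir orbT.
rewrite mulnS -{1}(subnKC le_ir) addnC leq_add2l leq_pmull // subn_gt0.
exact: leq_trans lt_ir le_rm.
Qed.

Lemma leq_bin_ratio n m r t : (r <= m)%N -> (n <= m * t)%N ->
  ('C(n, r) <= 'C(m, r) * (r * t) ^ r)%N.
Proof.
move=> le_rm le_n; rewrite -(leq_pmul2r (fact_gt0 r)) mulnAC !bin_ffact.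
have le_ffact : (n ^_ r <= n ^ r)%N.
  rewrite ffact_prod -[X in (_ <= _ ^ X)%N](card_ord r) -prod_nat_const.
  by apply: leq_prod => i _; exact: leq_subr.
apply: leq_trans le_ffact _; apply: (@leq_trans ((m * t) ^ r)).
  by case: r {le_rm} => // r; rewrite leq_exp2r.
by rewrite !expnMn mulnA leq_mul2r leq_expn_ffact // orbT.
Qed.

Lemma leq_bin_expn n r : ('C(n, r) <= n ^ r)%N.
Proof.
rewrite -(leq_pmul2r (fact_gt0 r)) bin_ffact.
apply: (@leq_trans (n ^ r)); last by rewrite leq_pmulr // fact_gt0.
rewrite ffact_prod -[X in (_ <= _ ^ X)%N](card_ord r) -prod_nat_const.
by apply: leq_prod => i _; exact: leq_subr.
Qed.

(** * Transversals of a Tverberg partition *)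

Section Selection.
Context {R : realType} {d : nat}.

Lemma conv_unionS N (T : 'I_N -> set 'rV[R]_d) (A : {set 'I_N}) (X : set 'rV[R]_d) :
  X `<=` \bigcup_(i in [set` A]) T i -> conv_hull X `<=` conv_union T A.
Proof. exact: conv_hull_mono. Qed.

(** The colours are the parts [B] in [E], the points of colour [B] being those of
    the sets with index in [B].  When [s] is empty the sets may be empty too, and
    any transversal is suitable. *)
Lemma transversal_hull N (T : 'I_N -> set 'rV[R]_d) (E : {set {set 'I_N}})
    (s : seq 'rV[R]_d) :
    (d * size s <= #|E|)%N -> (d < #|E|)%N ->
    (forall B, B \in E -> B != finset.set0) ->
    (forall B, B \in E -> conv_hull [set` s] `<=` conv_union T B) ->
  exists h : {set 'I_N} -> 'I_N, (forall B, B \in E -> h B \in B) /\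
    conv_hull [set` s] `<=` conv_union T (h @: E)%SET.
Proof.
move=> leE ltE neE sE.
pose K : finType := {B | B \in E}.
have cardK : #|K| = #|E| by rewrite card_sig; apply: eq_card.
have /card_gt0P[B0 B0E] : (0 < #|E|)%N by exact: leq_ltn_trans ltE.
have [i0 _] := set0Pn _ (neE B0 B0E).
(* from choices on the subtype K to choices on all sets *)
have extend (P : set 'rV[R]_d) : (exists g : K -> 'I_N, (forall B, g B \in val B) /\
      P `<=` conv_union T [set g B | B : K]%SET) ->
    exists h : {set 'I_N} -> 'I_N, (forall B, B \in E -> h B \in B) /\
      P `<=` conv_union T (h @: E)%SET.
  case=> g [gB gP]; exists (fun B => if insub B is Some B' then g B' else i0).
  split=> [B BE|]; first by case: insubP => [B' _ <-|/negP//]; exact: gB.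
  apply: classical_sets.subset_trans gP _; apply: conv_unionS => x [i /= /imsetP[B _ ->] Tx].
  exists (g B) => //=; apply/imsetP; exists (val B); first exact: (valP B).
  by rewrite valK.
apply: extend; have [s_gt0|] := ltnP 0 (size s).
  have [|||x [xT xs]] := @colourful_hull _ _ K (size s) (fun j => nth 0 s j)
      (fun B => \bigcup_(i in [set` val B]) T i) s_gt0.
  - by rewrite cardK.
  - by rewrite cardK.
  - move=> B j; apply: (sE _ (valP B)); apply: sub_conv_hull => /=.
    by rewrite mem_nth.
  have /choice[g gP] : forall B : K, exists i, i \in val B /\ T i (x B).
    by move=> B; have [i iB Ti] := xT B; exists i.
  exists g; split=> [B|]; first by have [] := gP B.
  apply: conv_hull_min; first exact: conv_hull_convex.
  move=> p /= /(nthP 0)[j js <-]; have := xs (Ordinal js); apply: conv_unionS.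
  move=> _ [B _ <-]; exists (g B); last by have [] := gP B.
  by apply/imsetP; exists B.
rewrite leqn0 => /eqP/size0nil ->.
have /choice[g gP] : forall B : K, exists i, i \in val B.
  by move=> B; have /set0Pn[i iB] := neE _ (valP B); exists i.
exists g; split=> //; apply: conv_hull_min; first exact: conv_hull_convex.
by move=> p.
Qed.

(** A transversal [h @: E] determines [E]: it is the set of the blocks of [Q]
    that the transversal meets. *)
Lemma count_transversals N (Q : {set {set 'I_N}}) r (P : {set 'I_N} -> Prop) :
    finset.trivIset Q ->
    (forall E : {set {set 'I_N}}, E \subset Q -> #|E| = r ->
       exists h : {set 'I_N} -> 'I_N,
         (forall B, B \in E -> h B \in B) /\ P (h @: E)%SET) ->
  ('C(#|Q|, r) <= #|[set A : {set 'I_N} | (#|A| == r) && `[< P A >]]%SET|)%N.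
Proof.
move=> tQ trans; rewrite -cards_draws.
set D := [set E | _]%SET.
have /choice[H HP] : forall E, exists A : {set 'I_N}, E \in D ->
    [/\ #|A| = r, P A & (finset.pblock Q @: A)%SET = E].
  move=> E; have [|nD] := boolP (E \in D); last by exists finset.set0.
  rewrite inE => /andP[EQ /eqP Er]; have [h [hE Ph]] := trans E EQ Er.
  have pblockh B : B \in E -> finset.pblock Q (h B) = B.
    by move=> BE; apply: (def_pblock tQ); [exact: (fintype.subsetP EQ)|exact: hE].
  exists (h @: E)%SET => _; split => //.
    rewrite card_in_imset // => B B' BE B'E /(congr1 (finset.pblock Q)).
    by rewrite !pblockh.
  apply/setP => B; apply/imsetP/idP => [[_ /imsetP[B' B'E ->] ->]|BE].
    by rewrite pblockh.
  by exists (h B); rewrite ?pblockh // imset_f.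
have Hinj : {in D &, injective H}.
  by move=> E E' /HP[_ _ {2}<-] /HP[_ _ {2}<-] ->.
rewrite -(card_in_imset Hinj); apply/subset_leq_card/fintype.subsetP => _ /imsetP[E ED ->].
by have [Ar PA _] := HP E ED; rewrite inE Ar eqxx /=; apply/asboolP.
Qed.

End Selection.

Theorem theorem2p8 (R : realType) (d : nat)
    (f : set 'rV[R]_d -> \bar R) (C : R -> nat)
    (f_ge0 : nonneg_on_convex f)
    (f_mono : monotone_on_convex f)
    (f_tverberg : admits_tverberg f)
    (f_approx : inscribed_polytope_approx f C) :
  admits_selection f C.
Proof.
move=> eps /andP[eps_gt0 eps_lt1].
have e2 : 0 < eps / 2 < 1 by lra.
have [t tP] := f_tverberg _ e2.
set r := selection_size d C eps.
have r_gt0 : (0 < r)%N by rewrite /r /selection_size addn1 leq_max orbT.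
(* [t] is positive as soon as there is a set to which the Tverberg property
   applies; until then [maxn] keeps the constant meaningful *)
exists (((r * maxn t 1) ^ r)%N%:R^-1).
  by rewrite invr_gt0 ltr0n expn_gt0 muln_gt0 r_gt0 leq_max orbT.
move=> lambda lambda_gt0 n T n_gt0 cT fT.
(* [t + 1] copies of one set are split into two nonempty parts *)
have t_gt0 : (0 < t)%N.
  have [||Q [partQ cardQ _]] :=
    tP 2%N isT lambda lambda_gt0 (fun=> T (Ordinal n_gt0)).
  - by move=> _; exact: cT.
  - by move=> _; exact: fT.
  have /and3P[_ _ neQ] := partQ.
  have : (#|Q| <= #|[set: 'I_((2 - 1) * t + 1)]%SET|)%N.
    rewrite (card_partition partQ) -sum1_card; apply: leq_sum => B BQ.
    by rewrite card_gt0; apply: contraNneq neQ => <-.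
  by rewrite cardsT card_ord cardQ mul1n addn1.
rewrite (maxn_idPl t_gt0).
have rt_gt0 : 0 < ((r * t) ^ r)%N%:R :> R by rewrite ltr0n expn_gt0 muln_gt0 r_gt0 t_gt0.
suff [T0 [cT0 fT0 countT0]] : exists T0 : set 'rV[R]_d,
    [/\ convex_set T0, ((lambda * (1 - eps))%:E <= f T0)%E &
      ('C(n, r) <= #|[set A : {set 'I_n} | (#|A| == r) &&
         `[< T0 `<=` conv_union T A >]]%SET| * (r * t) ^ r)%N].
  exists T0; split => //.
  by rewrite mulrC ler_pdivrMr // -natrM ler_nat.
(* the largest number of parts for which [(m - 1) * t + 1 <= n] *)
pose m := ((n - 1) %/ t)%N.+1.
have le_nmt : (n <= m * t)%N.
  by rewrite -[n](@subnK 1) // addn1 ltn_ceil.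
have [lt_mr|le_rm] := ltnP m r.
  exists (T (Ordinal n_gt0)); split; first exact: cT.
    apply: le_trans (fT _); rewrite lee_fin; nra.
  have [lt_nr|le_rn] := ltnP n r; first by rewrite bin_small.
  apply: (@leq_trans ((r * t) ^ r)%N).
    apply: leq_trans (leq_bin_expn _ _) _; rewrite leq_exp2r //.
    by apply: leq_trans le_nmt _; rewrite leq_mul2r (ltnW lt_mr) orbT.
  rewrite leq_pmull // card_gt0; apply/set0Pn.
  exists [set widen_ord le_rn i | i : 'I_r]%SET; rewrite inE.
  rewrite card_imset ?card_ord ?eqxx /=; last first.
    by move=> i j /(congr1 val) /= /val_inj.
  apply/asboolP => x Tx; apply: sub_conv_hull; exists (Ordinal n_gt0) => //=.
  by apply/imsetP; exists (Ordinal r_gt0) => //; exact: val_inj.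
have le_Nn : ((m - 1) * t + 1 <= n)%N.
  rewrite subn1 /= addn1 -[n in (_ < n)%N](@subnK 1) // addn1 ltnS.
  exact: leq_divM.
pose T' i := T (widen_ord le_Nn i).
have [|Q [partQ cardQ fQ]] := tP m isT lambda lambda_gt0 T' (fun=> cT _).
  by move=> i; exact: fT.
have /and3P[_ trivQ neQ] := partQ.
set X := \bigcap_(A in [set` Q]) conv_union T' A in fQ.
have cX : convex_set X.
  apply/convex_setP => x y s s01 Xx Xy B BQ.
  by have /convex_setP := @conv_hull_convex _ _ (\bigcup_(i in [set` B]) T' i);
     apply; [|exact: Xx|exact: Xy].
have l2 : 0 <= lambda * (1 - eps / 2) by nra.
have [P [polyP PX vertP fP]] := f_approx _ e2 _ l2 X cX fQ.
have [s us [PE sV]] := polytope_vertices polyP.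
have le_s : (size s <= C (eps / 2))%N.
  by have := size_le_card 0 us sV; apply; exact: vertP.
exists P; split.
- by rewrite PE; exact: conv_hull_convex.
- by apply: le_trans fP; rewrite lee_fin; nra.
apply: leq_trans (leq_bin_ratio le_rm le_nmt) _.
rewrite leq_mul2r -[X in 'C(X, _)]cardQ; apply/orP; right.
have inj_widen : injective (widen_ord le_Nn).
  by move=> i j /(congr1 val) /= /val_inj.
apply: leq_trans
  (@count_transversals _ Q r (fun A => P `<=` conv_union T' A) trivQ _) _.
  move=> E EQ Er; rewrite PE; apply: transversal_hull; rewrite ?Er.
  - by apply: leq_trans (leq_maxl _ _); rewrite leq_mul2l le_s orbT.
  - by rewrite /r /selection_size addn1 leq_maxr.
  - move=> B /(fintype.subsetP EQ) BQ.
    by apply: contraNneq neQ => <-.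
  - by move=> B /(fintype.subsetP EQ) BQ; rewrite -PE => x /PX; apply.
rewrite -(card_imset _ (imset_inj inj_widen)); apply/subset_leq_card.
apply/fintype.subsetP => _ /imsetP[A + ->]; rewrite !inE => /andP[Ar /asboolP PA].
rewrite card_imset // Ar /=; apply/asboolP.
apply: classical_sets.subset_trans PA _; apply: conv_unionS => x [i iA Tx].
by exists (widen_ord le_Nn i) => //=; exact: imset_f.
Qed.
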